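(* Let $K,L\ge 0$ be integers, $n=K+L+1$, and $\mu=(K+1,1^L)$. The set $\mathcal D$ of drawings associated to $\mu$ has cardinality $n!$.
   Context: A shape associated to $\mu=(K+1,1^L)$ is a choice of $K$ of the places $1,\dots,K+L$ (numbered from left to right) to be $y$-columns, the $L$ other places being $x$-columns. From left to right the $y$-columns have $K,K-1,\dots,1$ cells and the $x$-columns have $L,L-1,\dots,1$ cells. A drawing consists of a shape together with, for each column, a number of crosses between $0$ and the number of cells of the column (cells without a cross are called white; only the number of crosses in each column matters), subject to the following rules. (1) The number of crosses in an $x$-column is arbitrary. (2) If a $y$-column has no $x$-column to its right, its number of crosses is arbitrary. If a $y$-column has some $x$-column to its right, consider the first (nearest) $x$-column to its right which is plain, i.e. all of whose cells are crossed (full) or all of whose cells are white (empty); one exists since the last $x$-column has one cell. If this plain $x$-column is empty, the $y$-column must have at least one cross; if it is full, the $y$-column must have at least one white cell. $\mathcal D$ is the set of all drawings. *)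

(* Defs.v *)
From mathcomp Require Import all_boot.

Set Implicit Arguments.
Unset Strict Implicit.
Unset Printing Implicit Defensive.

Section Drawings.

Variables K L : nat.

(* Drawings of the partition (K+1, 1^L).  The places 1, ..., K+L are numbered
   0, ..., K+L-1 here. *)
Definition place := 'I_(K + L).

(* A shape is the set of its y-columns; the other places are x-columns. *)
Definition is_shape (Y : {set place}) : bool := #|Y| == K.

(* For a shape, the values on the y-columns are K, K-1, ..., 1 from left to
   right, and those on the x-columns are L, L-1, ..., 1. *)
Definition ncells (Y : {set place}) (i : place) : nat :=
  if i \in Y then K - #|[set j in Y | j < i]|
  else L - #|[set j in ~: Y | j < i]|.

(* Numbers of crosses, column by column.  The codomain {0, ..., K+L} only
   serves to have a finite type: no column has more than K+L cells, and the
   actual bound [ncells] is imposed in [is_drawing]. *)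
Definition crosses := {ffun place -> 'I_(K + L).+1}.

Definition col_empty (c : crosses) (i : place) : bool := c i == 0 :> nat.

Definition col_full (Y : {set place}) (c : crosses) (i : place) : bool :=
  c i == ncells Y i :> nat.

Definition plain_x (Y : {set place}) (c : crosses) (j : place) : bool :=
  (j \notin Y) && (col_full Y c j || col_empty c j).

Definition first_plain_x (Y : {set place}) (c : crosses) (i j : place) : bool :=
  [&& i < j, plain_x Y c j & [forall k : place, (i < k < j) ==> ~~ plain_x Y c k]].

(* If no x-column lies to the right of i, no j satisfies [first_plain_x] and
   the condition is void; otherwise exactly one j does, because the last
   x-column has a single cell and is therefore plain. *)
Definition y_rule (Y : {set place}) (c : crosses) (i : place) : bool :=
  [forall j : place, first_plain_x Y c i j ==>
     (col_empty c j ==> (0 < c i)) && (col_full Y c j ==> (c i < ncells Y i))].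

Definition is_drawing (d : {set place} * crosses) : bool :=
  [&& is_shape d.1,
      [forall i : place, d.2 i <= ncells d.1 i]
    & [forall i in d.1, y_rule d.1 d.2 i]].

Definition drawings : {set {set place} * crosses} := [set d | is_drawing d].

End Drawings.

(* Main.v *)
Require Import Defs.
From mathcomp Require Import all_boot.
From mathcomp Require Import zify.

(** Delete the leftmost column of a drawing: neither the sizes of the other
    columns nor the rules they obey change.  Conversely, an x-column with L cells
    can be put in front in L + 1 ways.  A y-column with K cells can be put in
    front in K + 1 ways if there is no x-column, and otherwise in K ways, because
    the nearest plain x-column forbids exactly one number of crosses.
    Hence, for K, L > 0, the number of drawings satisfies
    f(K, L) = (L + 1) f(K, L - 1) + K f(K - 1, L), which gives (K + L + 1)!. *)

Set Implicit Arguments.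
Unset Strict Implicit.
Unset Printing Implicit Defensive.

(* A drawing is encoded from left to right as a list of pairs: whether the
   column is a y-column, and its number of crosses. *)
Definition column := (bool * nat)%type.

(** * Rules on lists of columns *)

(** If [s] starts with a column of kind [b], this is also the number of cells of that column, as the
    sizes of each kind decrease to 1. *)
Definition cnt (b : bool) (s : seq column) := count (fun p => p.1 == b) s.
Arguments cnt : simpl never.

Definition plain (s : seq column) : bool :=
  if s is p :: s' then ~~ p.1 && ((p.2 == (cnt false s').+1) || (p.2 == 0))
  else false.

(* [Some true]: the first plain x-column is full; [Some false]: it is empty. *)
Fixpoint first_plain (s : seq column) : option bool :=
  if s is p :: s' then
    if plain s then Some (p.2 != 0) else first_plain s'
  else None.

Definition rule (f : option bool) (c N : nat) : bool :=
  match f with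
  | None => true
  | Some full => if full then c < N else 0 < c
  end.

Definition good_head (s : seq column) : bool :=
  if s is p :: s' then
    (p.2 <= cnt p.1 s) && (p.1 ==> rule (first_plain s') p.2 (cnt p.1 s))
  else true.

Fixpoint good (s : seq column) : bool :=
  if s is _ :: s' then good_head s && good s' else true.

Lemma good_cons p s : good (p :: s) = good_head (p :: s) && good s.
Proof. by []. Qed.

Lemma cnt_cons b p s : cnt b (p :: s) = (p.1 == b) + cnt b s.
Proof. by []. Qed.

Lemma cnt_size s : cnt true s + cnt false s = size s.
Proof. by elim: s => //= -[[] c] s; rewrite !cnt_cons /=; lia. Qed.

Lemma goodP s :
  reflect (forall i, i < size s -> good_head (drop i s)) (good s).
Proof.
elim: s => [|p s IHs]; first by apply: (iffP idP).
apply: (iffP andP) => [[hp /IHs hs] [|i] //= /hs //|h].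
by split; [exact: (h 0) | apply/IHs => i; exact: (h i.+1)].
Qed.

(** Bridge from the recursive search [first_plain] to the first plain position, as in [y_rule]. *)
Lemma ruleP c N p0 s :
  reflect (forall j, j < size s -> plain (drop j s) ->
             (forall k, k < j -> ~~ plain (drop k s)) ->
             if (nth p0 s j).2 == 0 then 0 < c else c < N)
          (rule (first_plain s) c N).
Proof.
elim: s => [|p s IHs]; first by apply: (iffP idP).
rewrite [first_plain _]/= -/(plain (p :: s)); case: ifP => hp.
  apply: (iffP idP) => [|/(_ 0 isT hp)] /=.
    by rewrite if_neg => h [|j] //= _ _ /(_ 0 isT); rewrite drop0 hp.
  by rewrite if_neg; apply.
apply: (iffP IHs) => h [|j] /=.
- by rewrite -/(plain (p :: s)) hp.
- by move=> js pl np; apply: h => // k; exact: (np k.+1).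
- by move=> js pl np; apply: (h 1) => // -[|k] //; rewrite drop0 hp.
- move=> js pl np; apply: (h j.+2) => // -[|k] hk; first by rewrite drop0 hp.
  exact: np.
Qed.

(** The last x-column has one cell, so it is plain and the search cannot fail once there is an
    x-column. *)
Lemma first_plain_cnt s :
  good s -> (first_plain s == None) = (cnt false s == 0).
Proof.
elim: s => //= -[[] c] s IHs /andP[/andP[/= hc _] /IHs {}IHs].
  by rewrite IHs.
(* A non-plain x-head has at least two cells, so another x-column follows it. *)
move: hc IHs; rewrite !cnt_cons /=; case: ifP => // hp hc ->; lia.
Qed.

(** * Putting a column in front *)

(** The new column has [(cnt b s).+1] cells, hence [(cnt b s).+2] candidates, 0 included. *)
Definition heads (b : bool) (s : seq column) : seq nat :=
  [seq c <- iota 0 (cnt b s).+2 | good_head ((b, c) :: s)].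

Definition prepend (b : bool) (E : seq (seq column)) : seq (seq column) :=
  [seq (b, c) :: s | s <- E, c <- heads b s].

Lemma mem_heads b s c : (c \in heads b s) = good_head ((b, c) :: s).
Proof.
rewrite mem_filter mem_iota /= cnt_cons eqxx; case: (_ ==> _); lia.
Qed.

Lemma mem_prepend b E p s :
  (p :: s \in prepend b E) = [&& p.1 == b, s \in E & good_head (p :: s)].
Proof.
apply/allpairsPdep/and3P => [[s' [c [hs]]]|[/eqP <- hs hp]].
  by rewrite mem_heads => hc [-> ->]; rewrite eqxx.
by exists s, p.2; rewrite mem_heads -surjective_pairing.
Qed.

Lemma nil_prepend b E : [::] \in prepend b E = false.
Proof. by apply/negP => /allpairsPdep[s [c []]]. Qed.

Lemma prepend_uniq b E : uniq E -> uniq (prepend b E).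
Proof.
move=> uE; apply: allpairs_uniq_dep => //.
  by move=> s _; rewrite filter_uniq ?iota_uniq.
by move=> [s c] [s' c'] _ _ /= [-> ->].
Qed.

Lemma size_prepend b E m :
  (forall s, s \in E -> size (heads b s) = m) ->
  size (prepend b E) = m * size E.
Proof.
rewrite size_allpairs_dep; elim: E => [|s E IHE] h /=; first by rewrite muln0.
rewrite h ?mem_head // IHE ?mulnS // => t tE.
by apply: h; rewrite inE tE orbT.
Qed.

Lemma size_heads_x s : size (heads false s) = (cnt false s).+2.
Proof.
rewrite size_filter (eq_in_count (a2 := predT)) ?count_predT ?size_iota // => c.
rewrite mem_iota /= cnt_cons /=; lia.
Qed.

Lemma size_heads_y s :
  good s -> size (heads true s) = (cnt true s + (cnt false s == 0)).+1.
Proof.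
move=> /first_plain_cnt <-; rewrite size_filter.
set N := cnt true s.
(* The excluded value [a] will be [N.+1] after a full plain column and 0 after an empty one. *)
have count_but a : a < N.+2 -> count (predC1 a) (iota 0 N.+2) = N.+1.
  move=> ha; have := count_predC (pred1 a) (iota 0 N.+2).
  by rewrite count_uniq_mem ?iota_uniq // mem_iota ha size_iota => -[].
rewrite (eq_count (a2 := fun c => (c <= N.+1) && rule (first_plain s) c N.+1)) //.
case: (first_plain s) => [[]|]; rewrite [nat_of_bool _]/= ?addn0 ?addn1.
- rewrite -[RHS](count_but N.+1) //; apply: eq_in_count => c.
  rewrite mem_iota /=; lia.
- rewrite -[RHS](count_but 0) //; apply: eq_in_count => c.
  rewrite mem_iota /=; lia.
rewrite -[RHS](size_iota 0) -count_predT; apply: eq_in_count => c.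
rewrite mem_iota /=; lia.
Qed.

(** * Enumeration of the good lists *)

Fixpoint words (n K : nat) : seq (seq column) :=
  if n is n'.+1 then
    prepend false (words n' K) ++
    (if K is K'.+1 then prepend true (words n' K') else [::])
  else if K == 0 then [:: [::]] else [::].

Lemma mem_words n K (s : seq column) :
  (s \in words n K) = [&& size s == n, cnt true s == K & good s].
Proof.
elim: n K s => [|n IHn] K s /=.
  by case: K => [|K] /=; rewrite ?inE; case: s.
rewrite mem_cat; case: s => [|p s].
  by rewrite nil_prepend; case: K => // K; rewrite nil_prepend.
have -> : (p :: s \in if K is K'.+1 then prepend true (words n K') else [::]) =
    [&& p.1, size s == n, (cnt true s).+1 == K, good s & good_head (p :: s)].
  case: K => [|K]; first by rewrite !andbF.
  by rewrite mem_prepend IHn eqb_id -!andbA.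
rewrite mem_prepend IHn cnt_cons good_cons -[size (p :: s)]/(size s).+1 eqSS.
move: (good_head _) (good s) => g g'.
by case: p.1; case: g g' => -[]; rewrite ?andbT ?andbF ?orbF.
Qed.

Lemma words_uniq n K : uniq (words n K).
Proof.
elim: n K => [|n IHn] K /=; first by case: ifP.
rewrite cat_uniq prepend_uniq //=; case: K => //= K.
(* The two halves are disjoint: their lists differ in the kind of the head. *)
rewrite prepend_uniq // andbT; apply/hasPn => -[|[b c] s].
  by rewrite nil_prepend.
by rewrite !mem_prepend => /and3P[/eqP/= ->].
Qed.

Lemma words_nil n K : n < K -> words n K = [::].
Proof.
move=> nK; case E: (words n K) => [//|s t].
have : s \in words n K by rewrite E mem_head.
by rewrite mem_words => /and3P[/eqP hs /eqP hK _]; have := cnt_size s; lia.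
Qed.

(** The total is independent of [K]: for [K <= n], the halves of [words n.+1 K] are [n + 2 - K] and
    [K] times the same factorial. *)
Lemma size_words n K : K <= n -> size (words n K) = n.+1`!.
Proof.
elim: n K => [|n IHn] K; first by case: K.
move=> hK /=; rewrite size_cat.
have -> : size (prepend false (words n K)) = (n.+1 - K).+1 * size (words n K).
  apply: size_prepend => s; rewrite mem_words => /and3P[/eqP hs /eqP hc _].
  rewrite size_heads_x; have := cnt_size s; lia.
(* The tails have no x-column exactly when [K == n.+1]. *)
have -> : size (if K is K'.+1 then prepend true (words n K') else [::]) =
    (K + (K == n.+1)) * n.+1`!.
  case: K hK => [|K] hK //; rewrite -(IHn K) //; apply: size_prepend => s.
  rewrite mem_words => /and3P[/eqP hs /eqP hc /size_heads_y ->].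
  have := cnt_size s; lia.
(* If [K = n.+1], the x-half is empty and the extra choice for a y-head makes up for it. *)
move: hK; rewrite leq_eqVlt => /predU1P[->|hK].
  by rewrite words_nil // muln0 eqxx addn1.
rewrite IHn // -mulnDl [RHS]factS; congr (_ * _); lia.
Qed.

(** * Drawings as good lists *)

Section Encoding.

Variables K L : nat.
Implicit Types (d : {set place K L} * crosses K L) (i j : place K L).

Definition word d : seq column :=
  [seq (i \in d.1, val (d.2 i)) | i <- enum 'I_(K + L)].

Lemma size_word d : size (word d) = K + L.
Proof. by rewrite size_map size_enum_ord. Qed.

Lemma nth_word p0 d i : nth p0 (word d) i = (i \in d.1, val (d.2 i)).
Proof. by rewrite (nth_map i) ?size_enum_ord ?nth_ord_enum. Qed.

Lemma word_inj : injective word.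
Proof.
move=> d d' eq_dd'.
have eq_i i : (i \in d.1, val (d.2 i)) = (i \in d'.1, val (d'.2 i)).
  by rewrite -!(nth_word (true, 0)) eq_dd'.
case: d d' eq_i {eq_dd'} => [Y c] [Y' c'] /= eq_i; congr (_, _).
  by apply/setP => i; case: (eq_i i).
by apply/ffunP => i; apply/val_inj; case: (eq_i i).
Qed.

Lemma drop_word d i :
  drop i (word d) = (i \in d.1, val (d.2 i)) :: drop i.+1 (word d).
Proof. by rewrite (drop_nth (true, 0)) ?size_word // nth_word. Qed.

Lemma cnt_word b d : cnt b (word d) = #|[set j : place K L | (j \in d.1) == b]|.
Proof. by rewrite /cnt count_map cardsE cardE size_filter enumT. Qed.

Lemma cnt_take_word b d i :
  cnt b (take i (word d)) =
  #|[set j : place K L | ((j \in d.1) == b) && (j < i)]|.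
Proof.
(* Places are enumerated in increasing order, so a prefix consists of the places below [i]. *)
have take_enum : take i (enum 'I_(K + L)) =
      [seq j : place K L <- enum 'I_(K + L) | j < i].
  apply: (inj_map val_inj); rewrite map_take val_enum_ord.
  rewrite -[RHS](filter_map val (fun k => k < i)) val_enum_ord.
  have i_le := ltnW (ltn_ord i).
  by rewrite take_iota (minn_idPl i_le) (@filter_iota_ltn 0).
rewrite /word -map_take take_enum /cnt count_map count_filter cardsE cardE.
by rewrite size_filter enumT.
Qed.

(** [ncells] subtracts the columns to the left from the total of that kind; the shape condition
    gives the totals [K] and [L], and the suffix from [i] on remains. *)
Lemma ncells_word d i :
  is_shape d.1 -> ncells d.1 i = cnt (i \in d.1) (drop i (word d)).
Proof.
move=> /eqP shape_d.
have cnt_drop b :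
    cnt b (drop i (word d)) = cnt b (word d) - cnt b (take i (word d)).
  by rewrite /cnt -{2}(cat_take_drop i (word d)) count_cat addKn.
have cntT : cnt true (word d) = K.
  by rewrite cnt_word -[RHS]shape_d; apply: eq_card => j; rewrite inE eqb_id.
have cntF : cnt false (word d) = L.
  by have := cnt_size (word d); rewrite cntT size_word => /addnI.
rewrite /ncells cnt_drop cnt_take_word; case: ifP => _.
  by rewrite cntT; congr (_ - _); apply: eq_card => j; rewrite !inE eqb_id.
by rewrite cntF; congr (_ - _); apply: eq_card => j; rewrite !inE eqbF_neg.
Qed.

Lemma plain_word d j :
  is_shape d.1 -> plain (drop j (word d)) = plain_x d.1 d.2 j.
Proof.
move=> shape_d; rewrite /plain_x /col_full /col_empty ncells_word // drop_word.
by rewrite /= cnt_cons; case: (j \in d.1).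
Qed.

Lemma y_rule_word d i :
  is_shape d.1 ->
  y_rule d.1 d.2 i =
  rule (first_plain (drop i.+1 (word d))) (d.2 i) (ncells d.1 i).
Proof.
move=> shape_d.
(* An x-column has at least one cell, so a plain one is either empty or full, never both. *)
have plainE j : plain_x d.1 d.2 j -> 
    ((col_empty d.2 j ==> (0 < d.2 i)) &&
     (col_full d.1 d.2 j ==> (d.2 i < ncells d.1 i))) =
    (if val (d.2 j) == 0 then 0 < d.2 i else d.2 i < ncells d.1 i).
  rewrite /plain_x /col_full /col_empty ncells_word // => /andP[/negbTE hj].
  by rewrite drop_word hj cnt_cons /=; case: eqP => [->|_] //= ->; rewrite andbT.
(* Position [m] of the suffix is the place [i.+1 + m]; both directions use this shift. *)
apply/forallP/(ruleP _ _ (true, 0)) => [h j' | h j].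
  rewrite size_drop size_word ltn_subRL nth_drop => jn.
  rewrite drop_drop addnC -[i.+1 + j']/(val (Ordinal jn)) nth_word.
  set j := Ordinal jn; rewrite plain_word // => plj npl /=.
  rewrite -plainE //; apply: (implyP (h j)); apply/and3P; split=> //.
    by rewrite /= addSn ltnS leq_addr.
  apply/forallP => k; apply/implyP => /andP[ik kj].
  rewrite -plain_word //; have := npl (k - i.+1).
  by rewrite drop_drop subnK //; apply; rewrite ltn_subLR.
apply/implyP => /and3P[ij plj /forallP npl]; rewrite plainE //.
have jn : j - i.+1 < K + L - i.+1.
  by rewrite ltn_sub2r // (leq_ltn_trans ij).
have := h (j - i.+1); rewrite size_drop size_word jn.
rewrite nth_drop drop_drop subnK // subnKC // nth_word plain_word //=.
apply=> // k hk; rewrite drop_drop addnC.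
have kj : i.+1 + k < j by rewrite -ltn_subRL.
have kn := ltn_trans kj (ltn_ord j).
rewrite -[i.+1 + k]/(val (Ordinal kn)) plain_word //.
by apply: (implyP (npl _)); rewrite /= kj addSn ltnS leq_addr.
Qed.

Lemma is_drawing_word d : is_drawing d = (word d \in words (K + L) K).
Proof.
rewrite mem_words size_word eqxx /= /is_drawing.
have -> : (cnt true (word d) == K) = is_shape d.1.
  rewrite cnt_word; congr (_ == _).
  by apply: eq_card => j; rewrite inE eqb_id.
case: (boolP (is_shape d.1)) => //= shape_d.
have headE i : good_head (drop i (word d)) =
    (d.2 i <= ncells d.1 i) && ((i \in d.1) ==> y_rule d.1 d.2 i).
  by rewrite y_rule_word // ncells_word // drop_word.
apply/andP/goodP => [[/forallP hc /forallP hr] i | h].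
  rewrite size_word => hi; rewrite -[i]/(val (Ordinal hi)) headE hc.
  exact: hr.
split; apply/forallP => i; have := h i; rewrite size_word headE.
  by move=> /(_ (ltn_ord i))/andP[].
by move=> /(_ (ltn_ord i))/andP[].
Qed.

Lemma words_word s : s \in words (K + L) K -> exists d, s = word d.
Proof.
rewrite mem_words => /and3P[/eqP size_s _ /goodP good_s].
pose p0 : column := (true, 0).
(* [inord] keeps the values: in a good list, no column has more than [K + L] crosses. *)
exists ([set i : place K L | (nth p0 s i).1],
        [ffun i : place K L => inord (nth p0 s i).2]).
apply: (@eq_from_nth _ p0) => [|i]; rewrite size_s ?size_word // => hi.
rewrite (nth_word p0 _ (Ordinal hi)) /= inE ffunE /= inordK.
  exact: surjective_pairing.
have := good_s i; rewrite size_s => /(_ hi).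
rewrite (drop_nth p0) ?size_s // => /andP[hc _]; rewrite ltnS.
apply: leq_trans hc _; rewrite -(drop_nth p0) ?size_s //.
apply: leq_trans (count_size _ _) _.
by rewrite size_drop size_s leq_subr.
Qed.

End Encoding.

Theorem mainTheorem5 (K L n : nat) (hn : n = K + L + 1) :
  #|drawings K L| = n`!.
Proof.
rewrite hn addn1 -(@size_words (K + L) K) ?leq_addr // cardE.
(* Two duplicate-free lists with the same members have the same size. *)
rewrite -(size_map (@word K L)); apply/perm_size/uniq_perm.
- by rewrite map_inj_uniq ?enum_uniq //; exact: word_inj.
- exact: words_uniq.
move=> s; apply/mapP/idP => [[d]|hs].
  by rewrite mem_enum inE is_drawing_word => hd ->.
have [d sE] := words_word hs; exists d => //.
by rewrite mem_enum inE is_drawing_word -sE.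
Qed.
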